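(* Let $F_m$ be the free group of rank $m\ge2$ with a finite generating set $X$. Then for every positive integer $n$, $$\mathrm{lcm}_{F_m,X}\left(B^\bullet_{F_m,X}(n)\right)\le 6n\,(\mathrm{w}_{F_m,X}(n))^2.$$
   Context: For a group $\Gamma$ with finite generating set $X$, $\|\cdot\|_X$ denotes word length with respect to $X$; $B_{\Gamma,X}(n)=\{\gamma\in\Gamma:\|\gamma\|_X\le n\}$, $B^\bullet_{\Gamma,X}(n)=B_{\Gamma,X}(n)\setminus\{1\}$ and $\mathrm{w}_{\Gamma,X}(n)=|B_{\Gamma,X}(n)|$. For a finite set $S$ of nontrivial elements of $\Gamma$, let $L_S=\bigcap_{\gamma\in S}\overline{\langle\gamma\rangle}$, where $\overline{\langle\gamma\rangle}$ is the normal closure in $\Gamma$ of the cyclic subgroup generated by $\gamma$. Let $\mathrm{LCM}_{\Gamma,X}(S)$ be the set of nontrivial elements of $L_S$ of minimal word length among nontrivial elements of $L_S$. Define $\mathrm{lcm}_{\Gamma,X}(S)=\|\delta\|_X$ for any $\delta\in\mathrm{LCM}_{\Gamma,X}(S)$ if this set is nonempty, and $\mathrm{lcm}_{\Gamma,X}(S)=0$ if it is empty. *)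

(* Defs.v *)
From HB Require Import structures.
From mathcomp Require Import all_boot finmap.
From mathcomp Require Import boolp classical_sets functions cardinality.

Set Implicit Arguments.
Unset Strict Implicit.
Unset Printing Implicit Defensive.

Local Open Scope classical_set_scope.
Local Open Scope group_scope.

(* Universal property: every map from the basis to a group H extends to a
   unique group morphism ({multiplicative G -> H} preserves 1 automatically,
   since G and H are groups). *)
Definition free_basis (I : Type) (G : groupType) (b : I -> G) : Prop :=
  forall (H : groupType) (f : I -> H),
    exists phi : {multiplicative G -> H},
      (forall i, phi (b i) = f i) /\
      (forall psi : {multiplicative G -> H},
          (forall i, psi (b i) = f i) -> psi =1 phi).

Definition free_group_of_rank (m : nat) (G : groupType) : Prop :=
  exists b : 'I_m -> G, free_basis b.

Section GroupLcm.
Variable G : groupType.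
Implicit Types (A H S : set G) (X : {fset G}) (x y : G) (w : seq G).

Definition subgroup H : Prop :=
  [/\ H 1, (forall x y, H x -> H y -> H (x * y)) & (forall x, H x -> H x^-1)].

Definition normal_subgroup H : Prop :=
  subgroup H /\ (forall x y, H x -> H (x ^ y)).

Definition generated_subgroup A : set G := smallest subgroup A.

Definition cyclic_subgroup x : set G := generated_subgroup [set x].

Definition normal_closure A : set G := smallest normal_subgroup A.

Definition generating_set X : Prop := generated_subgroup [set` X] = setT.

Definition word_in X w : bool := all (fun x => (x \in X) || (x^-1 \in X)) w.

Definition has_word_of_length X x (n : nat) : Prop :=
  exists w, [/\ word_in X w, size w = n & \prod_(y <- w) y = x].

(* The value 0 for an x outside the subgroup generated by X is a dummy: it
   does not occur when X is a generating set. *)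
Definition word_length X x : nat :=
  match pselect (exists n, `[< has_word_of_length X x n >]) with
  | left ex => ex_minn ex
  | right _ => 0%N
  end.

Definition ball X (n : nat) : set G := [set x | (word_length X x <= n)%N].

Definition punctured_ball X (n : nat) : set G := ball X n `\ 1.

(* fset_set sends an infinite set to the empty one, but balls are finite when
   X is a generating set, see finite_ball below. *)
Definition word_growth X (n : nat) : nat := #|` fset_set (ball X n)|.

Definition closure_intersection S : set G :=
  \bigcap_(x in S) normal_closure (cyclic_subgroup x).

Definition least_common_multiples X S : set G :=
  [set x | [/\ closure_intersection S x, x <> 1
    & forall y, closure_intersection S y -> y <> 1 ->
        (word_length X x <= word_length X y)%N]].

(* All elements of least_common_multiples X S have the same word length, so
   the value does not depend on the element selected by xget. *)
Definition group_lcm X S : nat :=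
  if pselect (least_common_multiples X S !=set0)
  then word_length X (xget 1 (least_common_multiples X S))
  else 0%N.

Lemma has_word X x : generating_set X ->
  exists n, has_word_of_length X x n.
Proof.
move=> Xgen; pose H := [set x | exists n, has_word_of_length X x n].
suff sub : generated_subgroup [set` X] `<=` H.
  by apply: sub; rewrite Xgen.
apply: smallest_sub => [|y /= yX]; last first.
  by exists 1%N, [:: y]; rewrite /word_in /= yX big_seq1.
split.
- by exists 0%N, [::]; rewrite big_nil.
- move=> y z [_ [u [uX _ <-]]] [_ [v [vX _ <-]]].
  exists (size (u ++ v)), (u ++ v); split=> //; last by rewrite big_cat.
  by rewrite /word_in all_cat; apply/andP.
- move=> y [_ [u [uX _ <-]]].
  exists (size u), (rev [seq z^-1 | z <- u]).
  split; last by rewrite -map_rev big_map prodgV revK.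
  + rewrite /word_in all_rev all_map; apply: sub_all uX => z /=.
    by rewrite invgK orbC.
  + by rewrite size_rev size_map.
Qed.

Lemma word_lengthP X x : generating_set X ->
  has_word_of_length X x (word_length X x) /\
  (forall n, has_word_of_length X x n -> (word_length X x <= n)%N).
Proof.
move=> /has_word-/(_ x)[n xn]; rewrite /word_length.
case: pselect => [ex|[]]; last by exists n; apply/asboolP.
case: ex_minnP => k /asboolP xk kmin; split=> // l xl.
by apply: kmin; apply/asboolP.
Qed.

Lemma finite_ball X n : generating_set X -> finite_set (ball X n).
Proof.
move=> Xgen.
pose L := [set` X] `|` [set x^-1 | x in [set` X]].
have Lfin : finite_set L.
  by rewrite finite_setU; split; [|apply: finite_image]; apply: finite_fset.
suff Bfin k : finite_set [set x | exists2 l, (l <= k)%N & has_word_of_length X x l].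
  apply: sub_finite_set (Bfin n) => x /= xn.
  by exists (word_length X x) => //; have [] := word_lengthP x Xgen.
elim: k => [|k IHk].
  apply: (@sub_finite_set _ _ [set 1]) => // x /= [l].
  by rewrite leqn0 => /eqP-> [w [_ /size0nil-> <-]]; rewrite big_nil.
apply: (@sub_finite_set _ _ ([set 1] `|` [set x * y | x in L & y in
  [set x | exists2 l, (l <= k)%N & has_word_of_length X x l]])).
  move=> x /= [l lk [[|y w] [/= wX sw <-]]]; first by left; rewrite big_nil.
  right; rewrite big_cons; case/andP: wX => yX wX.
  exists y; first by case/orP: yX => yX; [left|right; exists y^-1; rewrite ?invgK].
  exists (\prod_(z <- w) z) => //; exists (size w); last by exists w.
  by rewrite -ltnS sw.
by rewrite finite_setU; split=> //; apply: finite_image2.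
Qed.

End GroupLcm.

(* Main.v *)
(* The map sending the i-th element of the basis of F to the transvection
   u |-> u + t det(v_i, u) v_i of Z[t]^2, where v_i = (1, i), is a morphism
   F -> SL_2(Z[t]).  If g is a reduced product of l > 0 nontrivial powers of
   basis elements, then det(v_m, g v_m) has degree l in t, so g <> 1 acts by a
   nonscalar matrix.  For nonscalar 2x2 matrices over a domain commuting is a
   transitive relation, hence it is one on the nontrivial elements of F.

   If b <> 1 commuted with b^x for all x in X, then by transitivity it would
   commute with all its conjugates, which a computation with the first two
   transvections excludes.  So for a, b <> 1 there is y of length at most 1 with
   [a, b^y] <> 1.  Iterating such commutators along a balanced binary tree whose
   leaves are k elements of length at most n gives a nontrivial element of the
   intersection of their normal closures, of length at most 6nk^2 - 2nk - 2. *)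
From HB Require Import structures.
Require Import Defs.
From mathcomp Require Import all_boot finmap.
From mathcomp Require Import all_algebra ring zify.
From mathcomp Require Import boolp classical_sets functions cardinality.

Set Implicit Arguments.
Unset Strict Implicit.
Unset Printing Implicit Defensive.

Import GRing.Theory.

Local Open Scope classical_set_scope.
Local Open Scope group_scope.

Section SL2.
Variable R : comUnitRingType.
Local Open Scope ring_scope.

Definition SL2 := {M : 'M[R]_2 | \det M == 1}.
HB.instance Definition _ := [Choice of SL2 by <:].
HB.instance Definition _ := SubType.on SL2.

Implicit Types A B : SL2.

Lemma det_SL2 A : \det (val A) = 1.
Proof. exact/eqP/(valP A). Qed.

Lemma unitmx_SL2 A : val A \in unitmx.
Proof. by rewrite unitmxE det_SL2 unitr1. Qed.

Fact SL2_mul_subproof A B : \det (val A *m val B) == 1.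
Proof. by rewrite det_mulmx !det_SL2 mulr1. Qed.

Fact SL2_inv_subproof A : \det (invmx (val A)) == 1.
Proof. by rewrite det_inv det_SL2 invr1. Qed.

Definition SL2_one : SL2 := exist _ 1%:M (introT eqP (det1 R 2)).
Definition SL2_mul A B : SL2 := exist _ (_ : 'M_2) (SL2_mul_subproof A B).
Definition SL2_inv A : SL2 := exist _ (_ : 'M_2) (SL2_inv_subproof A).

Fact SL2_mulA : associative SL2_mul.
Proof. by move=> A B C; apply/val_inj/mulmxA. Qed.

Fact SL2_mul1g : left_id SL2_one SL2_mul.
Proof. by move=> A; apply/val_inj/mul1mx. Qed.

Fact SL2_mulg1 : right_id SL2_one SL2_mul.
Proof. by move=> A; apply/val_inj/mulmx1. Qed.

Fact SL2_mulVg : left_inverse SL2_one SL2_inv SL2_mul.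
Proof. by move=> A; apply/val_inj/mulVmx/unitmx_SL2. Qed.

Fact SL2_mulgV : right_inverse SL2_one SL2_inv SL2_mul.
Proof. by move=> A; apply/val_inj/mulmxV/unitmx_SL2. Qed.

HB.instance Definition _ := isGroup.Build SL2
  SL2_mulA SL2_mul1g SL2_mulg1 SL2_mulVg SL2_mulgV.

Lemma val_SL2M A B : val (A * B)%g = val A *m val B.
Proof. by []. Qed.

Lemma val_SL21 : val (1%g : SL2) = 1%:M.
Proof. by []. Qed.

End SL2.

Section Matrix2.
Local Open Scope ring_scope.

Lemma forall_ord2 (P : 'I_2 -> Prop) : P 0 -> P 1 -> forall i, P i.
Proof.
move=> P0 P1 [[|[|//]] lt_i].
  by have -> : Ordinal lt_i = 0 by apply/val_inj.
by have -> : Ordinal lt_i = 1 by apply/val_inj.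
Qed.

Lemma mulmx2E (R : comNzRingType) (A B : 'M[R]_2) i j :
  (A *m B) i j = A i 0 * B 0 j + A i 1 * B 1 j.
Proof.
rewrite mxE big_ord_recl big_ord1; congr (_ + A i _ * B _ j); exact/val_inj.
Qed.


Definition scalar2 (R : comNzRingType) (A : 'M[R]_2) : Prop :=
  [/\ A 0 0 = A 1 1, A 0 1 = 0 & A 1 0 = 0].

Lemma comm_mx2P (R : comNzRingType) (A B : 'M[R]_2) :
  A *m B = B *m A <->
  [/\ A 0 1 * B 1 0 = B 0 1 * A 1 0,
      (A 0 0 - A 1 1) * B 0 1 = (B 0 0 - B 1 1) * A 0 1
    & (A 0 0 - A 1 1) * B 1 0 = (B 0 0 - B 1 1) * A 1 0].
Proof.
split=> [AB | [e1 e2 e3]].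
  have E i j : A i 0 * B 0 j + A i 1 * B 1 j = B i 0 * A 0 j + B i 1 * A 1 j.
    by rewrite -!mulmx2E AB.
  have subI (x y x' y' : R) : x = y -> x' - y' = x - y -> x' = y'.
    by move=> -> /eqP; rewrite subrr subr_eq0 => /eqP.
  split.
  - by apply: subI (E 0 0) _; ring.
  - by apply: subI (E 0 1) _; ring.
  - by apply: subI (esym (E 1 0)) _; ring.
apply/matrixP => i j; rewrite !mulmx2E; apply/eqP; rewrite -subr_eq0; apply/eqP.
move: i j; do 2!apply: forall_ord2.
- by transitivity (A 0 1 * B 1 0 - B 0 1 * A 1 0); [ring | rewrite e1 subrr].
- transitivity ((A 0 0 - A 1 1) * B 0 1 - (B 0 0 - B 1 1) * A 0 1).
    by ring.
  by rewrite e2 subrr.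
- transitivity ((B 0 0 - B 1 1) * A 1 0 - (A 0 0 - A 1 1) * B 1 0).
    by ring.
  by rewrite e3 subrr.
- by transitivity (B 0 1 * A 1 0 - A 0 1 * B 1 0); [ring | rewrite e1 subrr].
Qed.

Lemma parallel_trans (R : idomainType) (a a1 a2 b b1 b2 c c1 c2 : R) : a != 0 ->
  a * b1 = b * a1 -> a * b2 = b * a2 -> a * c1 = c * a1 -> a * c2 = c * a2 ->
  b1 * c2 = c1 * b2.
Proof.
move=> a0 ab1 ab2 ac1 ac2; apply: (mulfI a0); apply: (mulfI a0).
transitivity (a * b1 * (a * c2)); first by ring.
rewrite ab1 ac2; transitivity (c * a1 * (b * a2)); first by ring.
by rewrite -ac1 -ab2; ring.
Qed.

Lemma comm_mx2_trans (R : idomainType) (A B C : 'M[R]_2) : ~ scalar2 A ->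
  A *m B = B *m A -> A *m C = C *m A -> B *m C = C *m B.
Proof.
move=> nsA /comm_mx2P[b1 b2 b3] /comm_mx2P[c1 c2 c3]; apply/comm_mx2P.
have flip (x y z t : R) : x * y = z * t -> t * z = y * x.
  by rewrite mulrC [RHS]mulrC => ->.
have [A0|A0] := eqVneq (A 0 0 - A 1 1) 0; last first.
  have K := mulrC (A 0 0 - A 1 1).
  by split; [exact: (parallel_trans A0 b2 b3 c2 c3) |
    exact: (parallel_trans A0 (K _) b2 (K _) c2) |
    exact: (parallel_trans A0 (K _) b3 (K _) c3)].
have [A1|A1] := eqVneq (A 0 1) 0; last first.
  have [[b2' c2'] K] := (flip _ _ _ _ b2, flip _ _ _ _ c2, mulrC (A 0 1)).
  by split; [exact: (parallel_trans A1 (K _) b1 (K _) c1) |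
    exact: (parallel_trans A1 b2' (K _) c2' (K _)) |
    exact: (parallel_trans A1 b2' b1 c2' c1)].
have [A2|A2] := eqVneq (A 1 0) 0; last first.
  have [[b3' c3'] K] := (flip _ _ _ _ b3, flip _ _ _ _ c3, mulrC (A 1 0)).
  have [b1' c1'] := (flip _ _ _ _ b1, flip _ _ _ _ c1).
  by split; [exact: (parallel_trans A2 b1' (K _) c1' (K _)) |
    exact: (parallel_trans A2 b3' b1' c3' c1') |
    exact: (parallel_trans A2 b3' (K _) c3' (K _))].
by case: nsA; split=> //; apply/eqP; rewrite -subr_eq0 A0.
Qed.

Definition transvection_mx (R : comNzRingType) (x s : R) : 'M[R]_2 :=
  \matrix_(i < 2, j < 2)
    (if i == 0 then if j == 0 then 1 - s * x else s
     else if j == 0 then - s * x ^+ 2 else 1 + s * x).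

Lemma det_transvection (R : comNzRingType) (x s : R) :
  \det (transvection_mx x s) = 1.
Proof.
rewrite (expand_det_row _ 0) !big_ord_recl big_ord0 /cofactor !det_mx11 !mxE /=.
by rewrite /bump /=; ring.
Qed.

Lemma transvection_mxD (R : comNzRingType) (x s t : R) :
  transvection_mx x s *m transvection_mx x t = transvection_mx x (s + t).
Proof.
by apply/matrixP; do 2!apply: forall_ord2; rewrite mulmx2E !mxE /=; ring.
Qed.

(* [area x z A] is the determinant of the columns [(1, x)] and [A (1, z)] *)
Definition area (R : comNzRingType) (x z : R) (A : 'M[R]_2) : R :=
  (A 1 0 + A 1 1 * z) - x * (A 0 0 + A 0 1 * z).

Lemma area_transvection (R : comNzRingType) (x y z s : R) (A : 'M[R]_2) :
  area y z (transvection_mx x s *m A) =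
  area y z A + s * (x - y) * area x z A.
Proof. by rewrite /area !mulmx2E !mxE /=; ring. Qed.

Lemma area_scalar (R : comNzRingType) (z : R) (A : 'M[R]_2) :
  scalar2 A -> area z z A = 0.
Proof. by rewrite /area => -[-> -> ->]; ring. Qed.

Lemma comm_conj_transvection (R : idomainType) (s : R) (A B : 'M[R]_2) :
  s != 0 -> (2 : R) != 0 ->
  transvection_mx 0 s *m B = A *m transvection_mx 0 s -> A *m B = B *m A ->
  A *m transvection_mx 0 s = transvection_mx 0 s *m A.
Proof.
move=> s0 n2 UB /comm_mx2P[_ e2 e3].
have E i j := congr1 (fun M : 'M_2 => M i j) UB.
move: (E 0 0) (E 0 1) (E 1 0) (E 1 1).
rewrite !mulmx2E !mxE /= => E00 E01 E10 E11.
have B10 : B 1 0 = A 1 0.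
  by transitivity (A 1 0 * (1 - s * 0) + A 1 1 * (- s * 0 ^+ 2));
    [rewrite -E10 | ]; ring.
have B11 : B 1 1 = A 1 0 * s + A 1 1.
  by transitivity (A 1 0 * s + A 1 1 * (1 + s * 0)); [rewrite -E11 | ]; ring.
have B00 : B 0 0 = A 0 0 - s * A 1 0.
  transitivity (A 0 0 * (1 - s * 0) + A 0 1 * (- s * 0 ^+ 2) - s * B 1 0).
    by rewrite -E00; ring.
  by rewrite B10; ring.
have B01 : B 0 1 = A 0 0 * s + A 0 1 - s * B 1 1.
  transitivity (A 0 0 * s + A 0 1 * (1 + s * 0) - s * B 1 1); last by ring.
  by rewrite -E01; ring.
have A10 : A 1 0 = 0.
  apply/eqP; rewrite -[_ == 0]orbb -mulf_eq0.
  rewrite -(mulrI_eq0 _ (mulfI (mulf_neq0 n2 s0))).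
  apply/eqP; transitivity ((A 0 0 - A 1 1) * B 1 0 - (B 0 0 - B 1 1) * A 1 0).
    by rewrite B10 B11 B00; ring.
  by rewrite e3 subrr.
have A00 : A 0 0 - A 1 1 = 0.
  apply/eqP; rewrite -[_ == 0]orbb -mulf_eq0 -(mulrI_eq0 _ (mulfI s0)).
  apply/eqP; transitivity ((A 0 0 - A 1 1) * B 0 1 - (B 0 0 - B 1 1) * A 0 1).
    by rewrite B01 B11 B00 A10; ring.
  by rewrite e2 subrr.
by apply/comm_mx2P; rewrite !mxE /= A10 A00; split; ring.
Qed.

Lemma transvections_conj_noncomm (R : idomainType) (s : R) (A : 'M[R]_2) :
  s != 0 ->
  transvection_mx 1 s *m A = transvection_mx 0 s *m transvection_mx 1 s ->
  transvection_mx 0 s *m A <> A *m transvection_mx 0 s.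
Proof.
move=> s0 VA /comm_mx2P[].
have E k l := congr1 (fun M : 'M_2 => M k l) VA.
move: (E 0 0) (E 1 0); rewrite !mulmx2E !mxE /= => E00 E10 e _ _.
have A10 : A 1 0 = 0 by apply: (mulfI s0); rewrite e; ring.
rewrite A10 in E00 E10.
have A00 : A 0 0 = 1.
  apply: (mulfI s0); apply: oppr_inj.
  transitivity (- s * 1 ^+ 2 * A 0 0 + (1 + s * 1) * 0); first by ring.
  by rewrite E10; ring.
rewrite A00 in E00.
suff /eqP : s * s = 0 by rewrite mulf_eq0 orbb (negPf s0).
transitivity ((1 - s * 1) * 1 + s * 0
    - ((1 - s * 0) * (1 - s * 1) + s * (- s * 1 ^+ 2))); first by ring.
by rewrite E00 subrr.
Qed.

End Matrix2.

Lemma balanced_bound (n p q lx lz l : nat) :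
  (0 < n)%N -> [&& 0 < p, p <= q & q <= p.+1]%N ->
  (lx + 2 * n * p + 2 <= 6 * n * p ^ 2)%N ->
  (lz + 2 * n * q + 2 <= 6 * n * q ^ 2)%N ->
  (l <= 2 * lx + 2 * (lz + 2))%N ->
  (l + 2 * n * (p + q) + 2 <= 6 * n * (p + q) ^ 2)%N.
Proof.
move=> n0 /and3P[p0]; rewrite leq_eqVlt => /predU1P[<- _|pq qp]; first by nia.
have -> : q = p.+1 by lia.
have : (n <= n * p)%N by rewrite leq_pmulr.
by nia.
Qed.

Section Groups.
Variable G : groupType.
Implicit Types (a b c x y : G) (X : {fset G}) (A : set G).

Lemma commuteJ a b x : commute a b -> commute (a ^ x) (b ^ x).
Proof. by rewrite /commute -!conjMg => ->. Qed.

Lemma generated_subgroup_ind A (P : G -> Prop) : generated_subgroup A = setT ->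
  subgroup P -> (forall x, A x -> P x) -> forall x, P x.
Proof.
move=> AT sP AP x; have : generated_subgroup A x by rewrite AT.
by apply; split.
Qed.

Lemma normal_closureJ A x y : normal_closure A x -> normal_closure A (x ^ y).
Proof. by move=> Ax N [nN AN]; apply: nN.2; apply: Ax. Qed.

Lemma normal_closure_commgl A x y :
  normal_closure A x -> normal_closure A [~ x, y].
Proof.
move=> Ax N [nN AN]; have [[_ NM NV] NJ] := nN.
by rewrite commgEl; apply: NM; [apply: NV; apply: Ax | apply: NJ; apply: Ax].
Qed.

Lemma normal_closure_commgr A x y :
  normal_closure A y -> normal_closure A [~ x, y].
Proof.
move=> Ax N [nN AN]; have [[_ NM NV] NJ] := nN.
by rewrite commgEr; apply: NM; [apply: NJ; apply: NV; apply: Ax | apply: Ax].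
Qed.

Lemma mem_normal_closure_cyclic x : normal_closure (cyclic_subgroup x) x.
Proof. by move=> N [_ AN]; apply: AN => H [_ xH]; apply: xH. Qed.

Definition commute_transitive : Prop :=
  forall a b c, a <> 1 -> commute a b -> commute a c -> commute b c.

Lemma commute_conj_gen X b : commute_transitive -> generating_set X -> b <> 1 ->
  (forall x, x \in X -> commute b (b ^ x)) -> forall g, commute b (b ^ g).
Proof.
move=> CT Xgen b1 bX; apply: (generated_subgroup_ind Xgen) => //.
split=> [|g h bg bh|g bg]; first by rewrite conjg1.
  rewrite conjgM; apply: (CT (b ^ h)).
  - by move/eqP; rewrite conjg_eq1 => /eqP.
  - exact: commute_sym.
  - exact: commuteJ.
by have /commute_sym := commuteJ g^-1 bg; rewrite conjgK.
Qed.

Section WordLength.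
Variable X : {fset G}.
Hypothesis Xgen : generating_set X.
Local Notation len := (word_length X).

Lemma word_length1 : len 1 = 0%N.
Proof.
apply/eqP; rewrite -leqn0; apply: (word_lengthP 1 Xgen).2.
by exists [::]; rewrite big_nil.
Qed.

Lemma word_length_gen x : x \in X -> (len x <= 1)%N.
Proof.
move=> xX; apply: (word_lengthP x Xgen).2.
by exists [:: x]; rewrite /word_in /= xX big_seq1.
Qed.

Lemma word_lengthM x y : (len (x * y) <= len x + len y)%N.
Proof.
have [[u [uX <- ux]] _] := word_lengthP x Xgen.
have [[v [vX <- vy]] _] := word_lengthP y Xgen.
apply: (word_lengthP _ Xgen).2; exists (u ++ v).
by rewrite size_cat big_cat /= ux vy /word_in all_cat; split=> //; apply/andP.
Qed.

Lemma word_lengthV x : (len x^-1 <= len x)%N.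
Proof.
have [[u [uX <- ux]] _] := word_lengthP x Xgen.
apply: (word_lengthP _ Xgen).2; exists (rev [seq z^-1 | z <- u]).
split; last by rewrite -map_rev big_map -ux prodgV revK.
- rewrite /word_in all_rev all_map; apply: sub_all uX => z /=.
  by rewrite invgK orbC.
- by rewrite size_rev size_map.
Qed.

Lemma word_lengthJ x y : (len (x ^ y) <= len x + 2 * len y)%N.
Proof.
rewrite conjgE (leq_trans (word_lengthM _ _)) // mul2n -addnn addnCA.
by rewrite leq_add ?word_lengthV // word_lengthM.
Qed.

Lemma word_lengthR x y : (len [~ x, y] <= 2 * len x + 2 * len y)%N.
Proof.
rewrite commgEl (leq_trans (word_lengthM _ _)) // [(2 * len x)%N]mul2n -addnn.
by rewrite -addnA leq_add ?word_lengthV ?word_lengthJ.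
Qed.

Lemma exists_common_multiple (n : nat) (s : seq G) :
  (forall a b, a <> 1 -> b <> 1 ->
     exists2 y, (len y <= 1)%N & ~ commute a (b ^ y)) ->
  (0 < n)%N -> (0 < size s)%N ->
  (forall x, x \in s -> x <> 1 /\ (len x <= n)%N) ->
  exists x, [/\ x <> 1,
      forall y, y \in s -> normal_closure (cyclic_subgroup y) x
    & (len x + 2 * n * size s + 2 <= 6 * n * size s ^ 2)%N].
Proof.
move=> noncomm n0; have [k] := ubnP (size s); elim: k s => // k IHk s sk s0 sP.
have [s1|s1] := leqP (size s) 1.
  case: s s1 s0 sP {sk} => [|x [|//]] //= _ _ /(_ x).
  rewrite inE eqxx => -[] // x1 xn.
  exists x; split=> //; last by lia.
  by move=> y; rewrite inE => /eqP->; apply: mem_normal_closure_cyclic.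
pose h := (size s)./2; have hE := odd_double_half (size s).
have sz1 : size (take h s) = h by rewrite size_takel // /h; lia.
have sz2 : size (drop h s) = (size s - h)%N by rewrite size_drop.
have [| | |x [x1 xs xn]] := IHk (take h s); rewrite ?sz1; [lia | lia | | ].
  by move=> y /mem_take; apply: sP.
have [| | |z [z1 zs zn]] := IHk (drop h s); rewrite ?sz2; [lia | lia | | ].
  by move=> y /mem_drop; apply: sP.
have [y y1 nxzy] := noncomm x z x1 z1.
exists [~ x, z ^ y]; split.
- by move/eqP/commgP/nxzy.
- move=> t; rewrite -[s in _ \in s](cat_take_drop h) mem_cat.
  move=> /orP[/xs|/zs] tx.
    exact: normal_closure_commgl.
  by apply: normal_closure_commgr; apply: normal_closureJ.
- have lenxzy : (len [~ x, z ^ y] <= 2 * len x + 2 * (len z + 2))%N.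
    apply: leq_trans (word_lengthR _ _) _; rewrite leq_add2l leq_mul2l /=.
    apply: leq_trans (word_lengthJ _ _) _.
    by rewrite leq_add2l -{2}[2]muln1 leq_mul2l.
  rewrite sz1 in xn; rewrite sz2 in zn.
  have hs : (h <= size s)%N by rewrite /h; lia.
  rewrite -{1 2}(subnKC hs); apply: balanced_bound xn zn lenxzy => //.
  by rewrite /h; lia.
Qed.

End WordLength.
End Groups.

Lemma subgroup_generated (G : groupType) (A : set G) :
  subgroup (generated_subgroup A).
Proof.
split=> [H [[]] //|x y Ax Ay H sAH|x Ax H sAH]; have [[_ HM HV] _] := sAH.
  by apply: HM; [apply: Ax | apply: Ay].
by apply: HV; apply: Ax.
Qed.

Section GeneratedSubgroupType.
Variables (G : groupType) (A : set G).

Definition generated_type := {x : G | `[< generated_subgroup A x >]}.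

Fact generated_closed :
  group_closed (fun x : G => `[< generated_subgroup A x >]).
Proof.
have [A1 AM AV] := subgroup_generated A.
split=> [|x y]; rewrite !unfold_in; first exact/asboolP.
by move=> /asboolP Ax /asboolP Ay; apply/asboolP; apply: AM (AV _ _).
Qed.

HB.instance Definition _ := SubType.on generated_type.
HB.instance Definition _ := [Choice of generated_type by <:].
HB.instance Definition _ :=
  SubChoice_isSubGroup.Build G _ generated_type generated_closed.

End GeneratedSubgroupType.

Lemma free_basis_generates (I : Type) (G : groupType) (b : I -> G) :
  free_basis b -> generated_subgroup (range b) = setT.
Proof.
move=> fb; apply/seteqP; split=> // x _.
have bP i : `[< generated_subgroup (range b) (b i) >].
  by apply/asboolP => H [_]; apply; exists i.
have [phi [phib _]] :=
  fb (generated_type (range b)) (fun i => exist _ (b i) (bP i)).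
have [theta [_ theta_uniq]] := fb G b.
have comp_theta : val \o phi =1 theta.
  by apply: (theta_uniq (val \o phi)) => i; rewrite /= phib.
have id_theta : idfun =1 theta by apply: (theta_uniq idfun).
have -> : x = val (phi x) by rewrite -[x in LHS]/(idfun x) id_theta -comp_theta.
exact/asboolP/(valP (phi x)).
Qed.

Section IntegerPowers.
Variable G : groupType.
Implicit Types (x : G) (k l : int).

Definition zpow x k : G :=
  match k with Posz n => x ^+ n | Negz n => x ^- n.+1 end.

Lemma zpowS x k : zpow x (k + 1)%R = x * zpow x k.
Proof.
case: k => [n|[|n]]; first by rewrite -PoszD addn1 /= expgS.
  by rewrite (_ : (Negz 0 + 1)%R = Posz 0) //= expg1 mulgV.
rewrite (_ : (_ + 1)%R = Negz n) //; last by rewrite !NegzE; ring.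
by rewrite /= [in RHS]expgSr invgM mulVKg.
Qed.

Lemma zpow_hom (f : int -> G) k :
  (forall k l, f (k + l)%R = f k * f l) -> zpow (f 1%R) k = f k.
Proof.
move=> fD; have f0 : f 0%R = 1.
  by apply: (mulgI (f 0%R)); rewrite -fD addr0 mulg1.
elim/int_ind: k => [|n IHn|n IHn]; first by rewrite f0.
  by rewrite -addn1 PoszD zpowS IHn addrC fD.
apply: (mulgI (f 1%R)); rewrite -zpowS -fD.
by rewrite (_ : (_ + 1)%R = (- n%:Z)%R) ?IHn; [congr f|]; rewrite ?intS; ring.
Qed.

Lemma zpowD x k l : zpow x (k + l)%R = zpow x k * zpow x l.
Proof.
elim/int_ind: k => [|n IHn|n IHn]; first by rewrite add0r mul1g.
  rewrite (_ : (_ + _)%R = (n%:Z + l + 1)%R); last by rewrite intS; ring.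
  by rewrite zpowS IHn mulgA -zpowS intS addrC.
apply: (mulgI x); rewrite mulgA -!zpowS.
rewrite (_ : (_ + 1)%R = (- n%:Z + l)%R); last by rewrite intS; ring.
by rewrite IHn; congr (zpow _ _ * _); rewrite intS; ring.
Qed.

End IntegerPowers.

Lemma gmulf_zpow (G H : groupType) (f : {multiplicative G -> H}) x k :
  f (zpow x k) = zpow (f x) k.
Proof.
rewrite -(zpow_hom (f := fun k => f (zpow x k))) // => i j.
by rewrite zpowD gmulfM.
Qed.

Section ReducedWords.
Variables (I : eqType) (G : groupType) (b : I -> G).

(* The first argument is the basis index of the leftmost factor. *)
Inductive reduced : option I -> G -> Prop :=
| reduced1 : reduced None 1
| reduced_cons i k o g : k != 0%R -> o != Some i -> reduced o g ->
    reduced (Some i) (zpow (b i) k * g).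

Lemma reducedM i k o g : reduced o g ->
  exists o', reduced o' (zpow (b i) k * g).
Proof.
have [-> rg|k0] := eqVneq k 0%R; first by exists o; rewrite mul1g.
case=> [|j l o' h l0 o'j rh].
  by exists (Some i); apply: reduced_cons k0 _ reduced1.
have [->|ij] := eqVneq i j; last first.
  exists (Some i); apply: reduced_cons k0 _ (reduced_cons l0 o'j rh).
  by rewrite eq_sym; apply: contra_neq ij => -[].
rewrite mulgA -zpowD; have [->|kl0] := eqVneq (k + l)%R 0%R.
  by exists o'; rewrite mul1g.
by exists (Some j); apply: reduced_cons kl0 o'j rh.
Qed.

Lemma generated_reduced g :
  generated_subgroup (range b) = setT -> exists o, reduced o g.
Proof.
move=> bT; pose P x := forall h o, reduced o h -> exists o', reduced o' (x * h).
suff [Pg _] : P g /\ P g^-1 by rewrite -[g]mulg1; apply: Pg reduced1.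
apply: (generated_subgroup_ind (P := fun g => P g /\ P g^-1) bT)
  => [|x [i _ <-]].
  split=> [|x y [Px Px'] [Py Py']|x [Px Px']]; last by rewrite invgK.
    by rewrite invg1; split=> h o rh; exists o; rewrite mul1g.
  split=> h o rh; rewrite ?invgM -mulgA.
    by have [o' rh'] := Py _ _ rh; apply: Px rh'.
  by have [o' rh'] := Px' _ _ rh; apply: Py' rh'.
by split=> h o; [apply: (reducedM i 1%R) | apply: (reducedM i (-1)%R)].
Qed.

End ReducedWords.

Lemma multiplicative1 (G H : groupType) (f : {multiplicative G -> H}) : f 1 = 1.
Proof. by apply: (mulgI (f 1)); rewrite -gmulfM !mulg1. Qed.

Section Transvections.
Variable R : comUnitRingType.

Definition transvection (x s : R) : SL2 R :=
  exist _ (transvection_mx x s) (introT eqP (det_transvection x s)).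

Lemma zpow_transvection (x s : R) k :
  zpow (transvection x s) k = transvection x (k%:~R * s)%R.
Proof.
rewrite -(zpow_hom (f := fun k : int => transvection x (k%:~R * s)%R)).
  by congr (zpow (transvection x _) _); rewrite mul1r.
move=> i j; apply/val_inj.
by rewrite val_SL2M /= transvection_mxD -mulrDl -intrD.
Qed.

End Transvections.

Lemma polyC_int (k : int) : (k%:P = k%:~R :> {poly int})%R.
Proof. by rewrite -{1}[k]intz rmorph_int. Qed.

Section FreeGroup.
Variables (m : nat) (F : groupType) (b : 'I_m -> F).
Hypothesis b_free : free_basis b.

Local Notation P := {poly int}.
Variable phi : {multiplicative F -> SL2 P}.
Hypothesis phi_b : forall i, phi (b i) = transvection (i%:R)%R ('X)%R.

Let a (j : nat) (g : F) : P := area (j%:R)%R (m%:R)%R (val (phi g)).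

Local Lemma a1 j : a j 1 = ((m%:Z - j%:Z)%R)%:P%R.
Proof.
by rewrite /a multiplicative1 val_SL21 /area !mxE /= polyCB !polyC_int; ring.
Qed.

Local Lemma aM j (i : 'I_m) k g :
  a j (zpow (b i) k * g) =
  (a j g + (k * (i%:Z - j%:Z))%:P * 'X * a i g)%R.
Proof.
rewrite /a gmulfM gmulf_zpow phi_b zpow_transvection val_SL2M area_transvection.
by rewrite polyCM polyCB !polyC_int; ring.
Qed.

Local Lemma size_a o g : reduced b o g -> exists l,
  [/\ forall j, (j <= m)%N -> (size (a j g) <= l.+1)%N,
      forall j, (j <= m)%N -> j != oapp val m o -> size (a j g) = l.+1
    & o != None -> (0 < l)%N].
Proof.
elim=> [|i k {}o {}g k0 oi rg [l [sle seq _]]].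
  exists 0%N; split=> // j _; rewrite a1 ?size_polyC ?leq_b1 // => jm.
  by rewrite subr_eq0 eqz_nat eq_sym jm.
have sai : size (a i g) = l.+1.
  apply: seq; first exact: ltnW.
  case: o oi {rg} => [j|] /=; last by rewrite ltn_eqF.
  by apply: contra_neq => ij; congr Some; apply/val_inj.
have step c : (c != 0)%R -> size (c%:P * 'X * a i g)%R = l.+2.
  move=> c0; rewrite -mulrA size_Cmul // mulrC size_mulX ?sai //.
  by rewrite -size_poly_eq0 sai.
have c0 (j : nat) : (i : nat) != j -> (k * (i%:Z - j%:Z) != 0)%R.
  by move=> ij; rewrite mulf_neq0 // subr_eq0 eqz_nat.
exists l.+1; split=> // j jm; rewrite aM.
  have [<-|/c0/step ij] := eqVneq (i : nat) j.
    by rewrite subrr mulr0 mul0r mul0r addr0 sai.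
  rewrite (leq_trans (size_polyD _ _)) // geq_max ij leqnn.
  by rewrite (leq_trans (sle _ jm)).
rewrite /= eq_sym => /c0/step ij.
by rewrite addrC size_polyDl ij // ltnS sle.
Qed.

Local Lemma phi_nonscalar g : g <> 1 -> ~ scalar2 (val (phi g)).
Proof.
move=> g1 /(area_scalar m%:R%R).
have [o rg] := generated_reduced g (free_basis_generates b_free).
have [l [_ seq lpos]] := size_a rg.
have o0 : o != None by case: rg g1 {seq lpos}.
have om : m != oapp val m o.
  by case: o o0 {rg seq lpos} => //= i _; rewrite gtn_eqF.
have := seq m (leqnn m) om; rewrite /a => sz a0.
by move: sz; rewrite a0 size_poly0.
Qed.

Local Lemma commute_phi x y :
  (val (phi x) *m val (phi y) = val (phi y) *m val (phi x))%R ->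
  commute x y.
Proof.
move=> xy; apply/commgP/negP => /negP/eqP/phi_nonscalar; apply.
have phixy : commute (phi x) (phi y) by apply/val_inj.
have -> : phi [~ x, y] = 1.
  apply: (mulgI (phi (y * x))); rewrite -gmulfM -commgC mulg1 !gmulfM.
  exact: phixy.
by rewrite val_SL21; split; rewrite !mxE.
Qed.

Local Lemma phi_commute x y : commute x y ->
  (val (phi x) *m val (phi y) = val (phi y) *m val (phi x))%R.
Proof. by move=> xy; rewrite -!val_SL2M -!gmulfM xy. Qed.

Local Lemma free_commute_transitive : commute_transitive F.
Proof.
move=> x y z x1 /phi_commute xy /phi_commute xz; apply: commute_phi.
exact: comm_mx2_trans (phi_nonscalar x1) xy xz.
Qed.

Local Lemma phi_commute_basis (i : 'I_m) x : i = 0%N :> nat ->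
  commute x (x ^ b i) -> commute x (b i).
Proof.
move=> i0 xx; apply: commute_phi; have := phi_commute xx.
rewrite phi_b i0 /=; apply: comm_conj_transvection; rewrite ?polyX_eq0 //.
  by rewrite -polyC_natr polyC_eq0.
have <- : val (phi (b i)) = transvection_mx 0%R 'X%R by rewrite phi_b i0.
by rewrite -!val_SL2M -!gmulfM -conjgC.
Qed.

Local Lemma noncommute_conj_basis (i j : 'I_m) :
  i = 0%N :> nat -> j = 1%N :> nat ->
  ~ commute (b i) (b i ^ b j).
Proof.
move=> i0 j1 /phi_commute; rewrite [phi (b i)]phi_b i0.
apply: transvections_conj_noncomm; first by rewrite polyX_eq0.
have <- : val (phi (b j)) = transvection_mx 1%R 'X%R by rewrite phi_b j1.
have <- : val (phi (b i)) = transvection_mx 0%R 'X%R by rewrite phi_b i0.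
by rewrite -!val_SL2M -!gmulfM -conjgC.
Qed.

Local Lemma exists_noncommuting_conj (x : F) :
  (1 < m)%N -> x <> 1 -> exists g, ~ commute x (x ^ g).
Proof.
move=> m1 x1; apply: contrapT => /forallNP cx.
have {}cx g : commute x (x ^ g) by apply: contrapT; apply: cx.
pose i : 'I_m := Ordinal (ltnW m1); pose j : 'I_m := Ordinal m1.
have xi g : commute (x ^ g) (b i).
  apply: phi_commute_basis => //; rewrite -conjgM.
  exact: free_commute_transitive x1 (cx _) (cx _).
have xi0 := xi 1; rewrite conjg1 in xi0.
apply: (@noncommute_conj_basis i j) => //.
apply: free_commute_transitive x1 xi0 _.
by have := commuteJ (b j) (xi (b j)^-1); rewrite conjgKV.
Qed.

End FreeGroup.

Lemma free_group_embedding (m : nat) (F : groupType) (b : 'I_m -> F) :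
  free_basis b -> exists phi : {multiplicative F -> SL2 {poly int}},
    forall i, phi (b i) = transvection i%:R%R ('X)%R.
Proof.
move=> /(_ (SL2 {poly int}) (fun i => transvection i%:R%R 'X%R))[phi [phib _]].
by exists phi.
Qed.

Theorem corollary4p2 (m : nat) (F : groupType) (X : {fset F}) (n : nat)
  (hm : (2 <= m)%N) (hF : free_group_of_rank m F)
  (hX : generating_set X) (hn : (0 < n)%N) :
  (group_lcm X (punctured_ball X n) <= 6 * n * word_growth X n ^ 2)%N.
Proof.
have [b b_free] := hF.
have [phi phi_b] := free_group_embedding b_free.
have CT := free_commute_transitive b_free phi_b.
have noncomm := exists_noncommuting_conj b_free phi_b hm.
have noncommX x y : x <> 1 -> y <> 1 ->
    exists2 z, (word_length X z <= 1)%N & ~ commute x (y ^ z).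
  move=> x1 y1; apply: contrapT => allc.
  have {}allc z : (word_length X z <= 1)%N -> commute x (y ^ z).
    by move=> z1; apply: contrapT => xyz; apply: allc; exists z.
  have [g] := noncomm y y1; apply; apply: (commute_conj_gen CT hX y1) => z zX.
  apply: CT x1 _ _; last by apply: allc; apply: word_length_gen.
  by rewrite -[y]conjg1; apply: allc; rewrite word_length1.
have [x0 [x0X x01]] : exists x, x \in X /\ x <> 1.
  apply: contrapT => X1; have F1 (x : F) : x = 1.
    move: x; apply: (generated_subgroup_ind hX) => [|y yX].
      by split=> // [y z -> ->|y ->]; rewrite ?mulg1 ?invg1.
    by apply: contrapT => y1; apply: X1; exists y.
  apply: (noncommute_conj_basis phi_b (erefl : Ordinal (ltnW hm) = 0%N :> nat)
    (erefl : Ordinal hm = 1%N :> nat)).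
  by rewrite [b _]F1 [_ ^ _]F1.
have B1fin : finite_set (punctured_ball X n).
  by apply: sub_finite_set (finite_ball n hX) => y [].
pose s := x0 :: fset_set (punctured_ball X n).
have [||x [x1 sx xlen]] := exists_common_multiple hX (s := s) noncommX hn.
- by [].
- move=> y; rewrite inE => /orP[/eqP->|].
    by rewrite (leq_trans (word_length_gen hX x0X)).
  by rewrite in_fset_set // inE => -[].
have size_s : (size s <= word_growth X n)%N.
  rewrite /word_growth (cardfsD1 1) -fset_setD1; last exact: finite_ball.
  rewrite in_fset_set ?mem_set //= /ball /= ?word_length1 //.
  exact: finite_ball.
have xL : closure_intersection (punctured_ball X n) x.
  by move=> y yB; apply: sx; rewrite inE in_fset_set // mem_set ?orbT.
rewrite /group_lcm; case: pselect => // -[z zM]; have [_ _ xmin] := xgetI 1 zM.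
apply: leq_trans (xmin x xL x1) _.
have : (6 * n * size s ^ 2 <= 6 * n * word_growth X n ^ 2)%N.
  by rewrite leq_mul2l leq_sqr size_s orbT.
by apply: leq_trans; apply: leq_trans xlen; rewrite -addnA leq_addr.
Qed.
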